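(* Let $A$ be an $n\times n$ rank two, positive semidefinite matrix with all its entries positive. Suppose $A$ has Hadamard power rank $k$. Let $r$ be a nonnegative real number. Then: (i) If $r>0$ and $r>k-2$, then $A^{\circ r}$ is positive semidefinite with rank $k$, and therefore $\mathrm{In}\,A^{\circ r}=(k,n-k,0)$. (ii) If $r\in\{0,1,\ldots,k-2\}$, then $A^{\circ r}$ is positive semidefinite with rank $r+1$, and therefore $\mathrm{In}\,A^{\circ r}=(r+1,n-r-1,0)$. (iii) If $0\le m<r<m+1\le k-2$ for some integer $m$, then $$\mathrm{In}\,A^{\circ r}=\left(\left\lfloor\frac{k+m+2}{2}\right\rfloor,\ n-k,\ \left\lceil\frac{k-m-2}{2}\right\rceil\right).$$ (iv) Every nonzero eigenvalue of $A^{\circ r}$ is simple.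
   Context: For a matrix $A=[a_{ij}]$ with positive entries, $A^{\circ r}=[a_{ij}^r]$ is its $r$th Hadamard (entrywise) power. The Hadamard power rank of a nonzero matrix $A$ is the largest integer $k$ for which there is a list of $k$ distinct columns of $A$ such that no column in the list is a scalar multiple of any other column in the list. The inertia of a Hermitian matrix $M$ is the triple $\mathrm{In}(M)=(n_+(M),n_0(M),n_-(M))$, where $n_+(M),n_0(M),n_-(M)$ are the numbers of positive, zero and negative eigenvalues of $M$, counted with multiplicity. *)

(* Defs.v *)
From HB Require Import structures.
From mathcomp Require Import all_boot all_order all_algebra.
From mathcomp Require Import polyrcf.
From mathcomp Require Import boolp reals exp.
Set Implicit Arguments.
Unset Strict Implicit.
Unset Printing Implicit Defensive.
Import Order.TTheory GRing.Theory Num.Theory.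
Local Open Scope ring_scope.

(* A complex Hermitian matrix with positive entries is real symmetric, so
   everything is stated over a realType R. *)

Definition psdmx (R : realType) (n : nat) (A : 'M[R]_n) : Prop :=
  A \is symmetricmx /\ forall x : 'cV[R]_n, 0 <= (x^T *m A *m x) 0 0.

(* Meant for matrices with positive entries only: powR sends a negative base to
   a junk value. *)
Definition hadamard_power (R : realType) (m n : nat) (A : 'M[R]_(m, n)) (r : R)
  : 'M[R]_(m, n) := \matrix_(i, j) (A i j `^ r).

(* A list of distinct columns is encoded by the set S of its indices. *)
Definition pairwise_nonproportional_cols (R : realType) (m n : nat)
    (A : 'M[R]_(m, n)) (S : {set 'I_n}) : Prop :=
  forall i j : 'I_n, i \in S -> j \in S -> i != j ->
    ~ exists c : R, col i A = c *: col j A.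

Definition hadamard_power_rank (R : realType) (m n : nat) (A : 'M[R]_(m, n))
  : nat :=
  (\max_(S : {set 'I_n} | `[< pairwise_nonproportional_cols A S >]) #|S|)%N.

Definition eig_mult (R : realType) (n : nat) (M : 'M[R]_n) (x : R) : nat :=
  mup x (char_poly M).

(* Only real eigenvalues are counted: for a real symmetric matrix these are all
   of them. [rootsR p] lists each real root of [p] once. *)
Definition n_pos (R : realType) (n : nat) (M : 'M[R]_n) : nat :=
  (\sum_(x <- rootsR (char_poly M) | (0 < x)%R) eig_mult M x)%N.

Definition n_zero (R : realType) (n : nat) (M : 'M[R]_n) : nat := eig_mult M 0.

Definition n_neg (R : realType) (n : nat) (M : 'M[R]_n) : nat :=
  (\sum_(x <- rootsR (char_poly M) | (x < 0)%R) eig_mult M x)%N.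

Definition inertia (R : realType) (n : nat) (M : 'M[R]_n) : nat * nat * nat :=
  (n_pos M, n_zero M, n_neg M).

(* Main.v *)
Require Import Defs.
From HB Require Import structures.
From mathcomp Require Import all_boot all_order all_algebra.
From mathcomp Require Import complex polyrcf ring lra zify.
From mathcomp Require Import boolp functions reals.
From mathcomp Require Import normedtype derive realfun exp.
Set Implicit Arguments.
Unset Strict Implicit.
Unset Printing Implicit Defensive.
Import Order.TTheory GRing.Theory Num.Theory.
Import numFieldNormedType.Exports.
Local Open Scope ring_scope.

(* Splitting off the first row and column of the rank two matrix A gives
   A i j = a i * a j * (1 + t i * t j) with a > 0, and k is the number of distinct
   t i.  If y lists these values increasingly, A^{o r} = W^T K W with
   K i j = (1 + y i * y j)^r and W of full row rank, so by Sylvester's law of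
   inertia everything is read off from K.
   If r is an integer <= k - 2, the binomial theorem factors K through a
   Vandermonde matrix.  Otherwise take, for each p, a combination f of the
   functions (1 + x y_0)^r, ..., (1 + x y_p)^r vanishing at y_0, ..., y_{p-1};
   the coefficient vectors triangularise K.  Dividing f by (1 + x y_0)^r and
   using Rolle's theorem shows that the p-th pivot has the sign of
   r (r - 1) ... (r - p + 1), which gives the inertia.
   For simplicity of the nonzero eigenvalues, an eigenvalue of multiplicity two
   would have an eigenvector whose first coordinate w_0 vanishes.  The function
   f = sum_j w_j (1 + x y_j)^r then vanishes at y_0 and between any two
   consecutive sign changes of w, that is, more often than w changes sign,
   contradicting the Descartes rule of signs for such sums. *)

(** * Sums of powers of affine functions *)

(** The value at [y i] is the i-th coordinate of [w *m affine_powmx y r], so zeros of this function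
    speak about the matrix K. *)
Definition powsum (R : realType) (p : nat) (w y : 'I_p -> R) (r x : R) : R :=
  \sum_j w j * (1 + x * y j) `^ r.

Lemma is_derive_affine_powR (R : realType) (y r x : R) : 0 < 1 + x * y ->
  is_derive x 1 (fun z => (1 + z * y) `^ r) (r * y * (1 + x * y) `^ (r - 1)).
Proof.
move=> h.
have d1 : is_derive x (1:R) (fun z : R => 1 + z * y) y.
  have -> : (fun z : R => 1 + z * y) = (cst 1 + y \*: (id : R -> R)).
    by apply/funext => z; rewrite mulrC.
  by apply: is_derive_eq; rewrite add0r [_ *: _]mulr1.
have d2 := is_derive1_powR r h.
have := @is_derive1_comp _ (fun z : R => z `^ r) (fun z : R => 1 + z * y) x _ _ d2 d1.
by rewrite mulrAC.
Qed.

(** Each term is a multiple of ((1 + x y) / (1 + x c))^r, and y (1 + x c) - c (1 + x y) = y - c,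
    whence the factor [y j - c]. *)
Lemma is_derive_powsum_quot (R : realType) (p : nat) (w y : 'I_p -> R)
    (c r x : R) :
  0 < 1 + x * c -> (forall j, 0 < 1 + x * y j) ->
  is_derive x 1 (fun z => powsum w y r z * (1 + z * c) `^ (- r))
   (r * (1 + x * c) `^ (- r - 1) *
     powsum (fun j => w j * (y j - c)) y (r - 1) x).
Proof.
move=> hc hy.
have d1 := is_derive_affine_powR (- r) hc.
have -> : (fun z => powsum w y r z * (1 + z * c) `^ (- r)) =
  \sum_j (w j \*: ((fun z => (1 + z * y j) `^ r)
                   * (fun z => (1 + z * c) `^ (- r)))).
  apply/funext => z; rewrite /powsum fct_sumE mulr_suml.
  by apply: eq_bigr => j _; rewrite -mulrA.
rewrite /powsum mulr_sumr.
apply: is_derive_sum => j.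
have d2 := is_derive_affine_powR r (hy j).
apply: is_derive_eq.
(* Pulling one factor out of each power leaves the exponents [- r - 1] and [r - 1] of the claim. *)
have pr (z : R) : 0 < z -> forall s, z `^ s = z * z `^ (s - 1).
  move=> z0 s; rewrite -{2}(powRr1 (ltW z0)) -powRD ?subrKC//.
  by rewrite (gt_eqF z0) implybT.
rewrite (pr _ hc (- r)) (pr _ (hy j) r) /GRing.scale /=.
ring.
Qed.

Lemma powsum_quot_MVT (R : realType) (p : nat) (w y : 'I_p -> R)
    (c r a b : R) : a < b ->
  (forall x, a <= x <= b -> 0 < 1 + x * c) ->
  (forall x, a <= x <= b -> forall j, 0 < 1 + x * y j) ->
  exists2 x, a < x < b &
    powsum w y r b * (1 + b * c) `^ (- r)
      - powsum w y r a * (1 + a * c) `^ (- r)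
    = r * (1 + x * c) `^ (- r - 1) *
       powsum (fun j => w j * (y j - c)) y (r - 1) x * (b - a).
Proof.
move=> ab hc hy.
pose f z := powsum w y r z * (1 + z * c) `^ (- r).
pose df x := r * (1 + x * c) `^ (- r - 1) *
  powsum (fun j => w j * (y j - c)) y (r - 1) x.
have D x : a <= x <= b -> is_derive x 1 f (df x).
  by move=> /[dup] /hc ? /hy ?; exact: is_derive_powsum_quot.
have Do x : x \in `]a, b[ -> is_derive x 1 f (df x).
  by rewrite in_itv /= => /andP[/ltW ax /ltW xb]; apply: D; rewrite ax.
have [|x] := MVT ab Do.
  apply: derivable_within_continuous => x; rewrite in_itv /= => /D d.
  exact: ex_derive.
by rewrite in_itv /= => ? ?; exists x.
Qed.

Definition falling (R : realType) (r : R) (p : nat) : R :=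
  \prod_(l < p) (r - l%:R).

Lemma fallingS (R : realType) (r : R) p :
  falling r p.+1 = r * falling (r - 1) p.
Proof.
rewrite /falling big_ord_recl subr0; congr (_ * _); apply: eq_bigr => i _.
by rewrite lift0 -addn1 natrD opprD addrA addrAC.
Qed.

Lemma powsum_recl (R : realType) (p : nat) (w y : 'I_p.+1 -> R) (r x : R) :
  powsum w y r x = w ord0 * (1 + x * y ord0) `^ r
    + powsum (w \o lift ord0) (y \o lift ord0) r x.
Proof. by rewrite /powsum big_ord_recl. Qed.

(** A single interval serves because the nodes and the points of evaluation are both taken from
    it. *)
Definition posdom (R : realType) (lo hi : R) :=
  forall u v, lo <= u <= hi -> lo <= v <= hi -> 0 < 1 + u * v.

(* After division by (1 + x y_0)^r the first term is constant; its derivative is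
   a sum of the same shape with one term fewer and exponent r - 1, vanishing
   between consecutive zeros. *)
Lemma powsum_sign (R : realType) (lo hi : R) (p : nat)
    (w y x : 'I_p.+1 -> R) (r : R) :
  posdom lo hi ->
  (forall j, lo <= y j <= hi) -> (forall j, lo <= x j <= hi) ->
  {homo y : i j / (i < j)%N >-> i < j} ->
  {homo x : i j / (i < j)%N >-> i < j} ->
  (forall i : 'I_p.+1, (i < p)%N -> powsum w y r (x i) = 0) ->
  falling r p != 0 -> (exists j, w j != 0) ->
  0 < w ord_max * powsum w y r (x ord_max) * falling r p.
Proof.
move=> J; elim: p => [|p IH] in w y x r *.
  move=> yJ xJ _ _ _ _ [j].
  have -> : ord_max = ord0 :> 'I_1 by exact: val_inj.
  rewrite (ord1 j) /powsum /falling big_ord0 big_ord1 mulr1 mulrA => w0.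
  by rewrite mulr_gt0 ?powR_gt0 ?J// -expr2 exprn_even_gt0.
move=> yJ xJ yh xh fx; rewrite fallingS mulf_eq0 negb_or => /andP[r0 ff0] wn0.
pose c := y ord0; have cJ : lo <= c <= hi by exact: yJ.
pose y' := y \o lift ord0.
pose w' j := w (lift ord0 j) * (y' j - c).
have wE z : powsum (fun j => w j * (y j - c)) y (r - 1) z = powsum w' y' (r - 1) z.
  by rewrite powsum_recl subrr mulr0 mul0r add0r.
(* The indices [lo' i] and [lift ord0 i] are i and i + 1. The sum is known to vanish at the left
   point for every i, but at the right one only for i < p; the last interval ties the value at
   [x ord_max] to the derivative. *)
pose lo' (i : 'I_p.+1) : 'I_p.+2 := widen_ord (leqnSn _) i.
have /choice[xi xiP] (i : 'I_p.+1) : exists z, x (lo' i) < z < x (lift ord0 i) /\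
    powsum w y r (x (lift ord0 i)) * (1 + x (lift ord0 i) * c) `^ (- r)
    = r * (1 + z * c) `^ (- r - 1) *
       powsum w' y' (r - 1) z * (x (lift ord0 i) - x (lo' i)).
  have lx : x (lo' i) < x (lift ord0 i) by apply: xh; rewrite lift0 /=.
  have xz z : x (lo' i) <= z <= x (lift ord0 i) -> lo <= z <= hi.
    move=> /andP[lz zh]; have /andP[a _] := xJ (lo' i).
    by have /andP[_ b] := xJ (lift ord0 i); rewrite (le_trans a lz) (le_trans zh b).
  have hc z : x (lo' i) <= z <= x (lift ord0 i) -> 0 < 1 + z * c.
    by move=> /xz ?; exact: J.
  have hy z : x (lo' i) <= z <= x (lift ord0 i) -> forall j, 0 < 1 + z * y j.
    by move=> /xz ? j; exact: J.
  have [z zI] := powsum_quot_MVT w r lx hc hy.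
  by rewrite (fx (lo' i) (ltn_ord i)) mul0r subr0 wE => ->; exists z.
have xiJ j : lo <= xi j <= hi.
  have [/andP[a b] _] := xiP j; have /andP[a' _] := xJ (lo' j).
  have /andP[_ b'] := xJ (lift ord0 j).
  by rewrite (le_trans a' (ltW a)) (le_trans (ltW b) b').
have bJ z : lo <= z <= hi -> 0 < 1 + z * c by move=> ?; exact: J.
have y'gt j : 0 < y' j - c by rewrite subr_gt0; apply: yh; rewrite lift0.
have lm : lift ord0 ord_max = ord_max :> 'I_p.+2 by exact: val_inj.
(* If all of [w'] vanished, only [w ord0] would survive, and the sum would be nonzero at
   [x ord0]. *)
have w'n0 : exists j, w' j != 0.
  have [//|/forallNP w'0] := pselect (exists j, w' j != 0).
  have w0 j : w (lift ord0 j) = 0.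
    have /negP := w'0 j; rewrite negbK mulf_eq0 (gt_eqF (y'gt j)) orbF.
    by move/eqP.
  have w00 : w ord0 != 0.
    by case: wn0 => j; case: (unliftP ord0 j) => [k|] ->//; rewrite w0 eqxx.
  have := fx ord0 isT; rewrite /powsum big_ord_recl big1.
    move/eqP; rewrite addr0 mulf_eq0 (negbTE w00)/= gt_eqF// powR_gt0//.
    exact: J.
  by move=> i _; rewrite w0 mul0r.
have xih : {homo xi : i j / (i < j)%N >-> i < j}.
  move=> i j ij; have [/andP[_ a] _] := xiP i; have [/andP[b _] _] := xiP j.
  apply: lt_trans a _; apply: le_lt_trans b.
  have [e|e] := eqVneq (lift ord0 i) (lo' j); first by rewrite e.
  apply/ltW/xh; rewrite lift0 /= ltn_neqAle ij andbT.
  by apply: contra e => /eqP e; apply/eqP/val_inj.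
have fxi (i : 'I_p.+1) : (i < p)%N -> powsum w' y' (r - 1) (xi i) = 0.
  move=> ip; have [/andP[a b]] := xiP i.
  rewrite fx ?lift0// mul0r => /esym/eqP; rewrite !mulf_eq0 (negbTE r0)/=.
  have ba : x (lo' i) < x (lift ord0 i) by exact: lt_trans a b.
  have /gt_eqF-> : 0 < (1 + xi i * c) `^ (- r - 1) by rewrite powR_gt0 ?bJ.
  by rewrite subr_eq0 (gt_eqF ba) orbF => /eqP.
have yh' : {homo y' : i j / (i < j)%N >-> i < j}.
  by move=> i j ij; apply: yh; rewrite !lift0.
have := IH w' y' xi (r - 1) (fun j => yJ _) xiJ yh' xih fxi ff0 w'n0.
rewrite /w' lm.
have [/andP[a b]] := xiP ord_max; rewrite lm.
set F := powsum w y r _; set G := powsum w' _ _ _; set B := _ `^ _; set C := _ `^ _.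
set d := x _ - _; set e := y' _ - _ => FG.
have B0 : 0 < B by rewrite powR_gt0 ?bJ.
have C0 : 0 < C by rewrite powR_gt0 ?bJ.
have d0 : 0 < d by rewrite subr_gt0 -lm (lt_trans a)// lm.
have e0 : 0 < e by exact: y'gt.
have -> : F = r * C * G * d / B by rewrite -FG mulfK ?gt_eqF.
move=> h.
(* One r from the derivative and one from [fallingS] form a square, so the sign is that of the
   induction hypothesis. *)
have -> : w ord_max * (r * C * G * d / B) * (r * falling (r - 1) p)
  = (w ord_max * e * G * falling (r - 1) p) * (r ^+ 2 * C * d / (B * e)).
  by field; rewrite !gt_eqF.
have r20 : 0 < r ^+ 2 by rewrite exprn_even_gt0.
apply: mulr_gt0 => //; apply: divr_gt0; last exact: mulr_gt0.
by apply: mulr_gt0 => //; apply: mulr_gt0.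
Qed.

Lemma powsumZ (R : realType) (p : nat) (w y : 'I_p -> R) (r x a : R) :
  powsum (fun j => a * w j) y r x = a * powsum w y r x.
Proof. by rewrite /powsum mulr_sumr; apply: eq_bigr => j _; rewrite mulrA. Qed.

(* The cuts cs mark the sign changes of w, so this is the rule of signs: a nonzero
   sum has at most as many zeros as sign changes.  Dividing by (1 + x c)^r and
   differentiating removes the cut c and at most one zero. *)
Lemma powsum_Descartes (R : realType) (lo hi : R) (p : nat) (y : 'I_p -> R)
    (cs : seq R) (w : 'I_p -> R) (x : 'I_(size cs).+1 -> R) (r : R) :
  posdom lo hi ->
  (forall j, lo <= y j <= hi) -> (forall j, lo <= x j <= hi) ->
  {in cs, forall c, lo <= c <= hi} ->
  {homo x : i j / (i < j)%N >-> i < j} ->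
  (forall j, 0 <= w j * \prod_(c <- cs) (c - y j)) ->
  (forall i, powsum w y r (x i) = 0) ->
  forall z, lo <= z <= hi -> powsum w y r z = 0.
Proof.
move=> J yJ; elim: cs => [|c cs IH] in w x r *.
  move=> xJ _ _ w0 fx z zJ.
  (* Without cuts all [w j] are nonnegative, so a single zero forces them all to vanish. *)
  suff wz j : w j = 0 by rewrite /powsum big1// => j _; rewrite wz mul0r.
  have w0' k : 0 <= w k by have := w0 k; rewrite big_nil mulr1.
  have /(_ j isT)/eqP := psumr_eq0P (fun j _ => mulr_ge0 (w0' j) (powR_ge0 _ r)) (fx ord0).
  by rewrite mulf_eq0 [X in _ || X]gt_eqF ?orbF ?powR_gt0 ?J// => /eqP.
move=> xJ csJ xh ws fx.
(* For r = 0 the sum is constant; otherwise r can be cancelled from the mean value identity. *)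
have [r0|r0] := eqVneq r 0.
  rewrite r0 in fx *; have E z : powsum w y 0 z = \sum_j w j.
    by apply: eq_bigr => j _; rewrite powRr0 mulr1.
  by move=> z _; rewrite E -(E (x ord0)) fx.
have cJ : lo <= c <= hi by apply: csJ; rewrite mem_head.
have csJ' : {in cs, forall c, lo <= c <= hi}.
  by move=> b bcs; apply: csJ; rewrite inE bcs orbT.
(* The factor is [c - y j], not [y j - c], so that the new coefficients inherit the sign condition
   for the remaining cuts as it stands. *)
have M a b : lo <= a <= hi -> lo <= b <= hi -> a < b -> exists2 z, a < z < b &
    powsum w y r b * (1 + b * c) `^ (- r)
      - powsum w y r a * (1 + a * c) `^ (- r)
    = - (r * (1 + z * c) `^ (- r - 1)) *
       powsum (fun j => w j * (c - y j)) y (r - 1) z * (b - a).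
  move=> /andP[loa _] /andP[_ bhi] ab.
  have zJ z : a <= z <= b -> lo <= z <= hi.
    by move=> /andP[az zb]; rewrite (le_trans loa)// (le_trans zb).
  have hc z : a <= z <= b -> 0 < 1 + z * c by move=> /zJ ?; exact: J.
  have hy z : a <= z <= b -> forall j, 0 < 1 + z * y j.
    by move=> /zJ ? j; exact: J.
  have [z zI ->] := powsum_quot_MVT w r ab hc hy.
  exists z => //.
  have -> : powsum (fun j => w j * (c - y j)) y (r - 1) z =
      - powsum (fun j => w j * (y j - c)) y (r - 1) z.
    by rewrite -[RHS]mulN1r -powsumZ; apply: eq_bigr => j _; rewrite mulN1r -mulrN opprB.
  by rewrite mulrNN.
have pc z s : lo <= z <= hi -> (1 + z * c) `^ s != 0.
  by move=> zJ; rewrite gt_eqF ?powR_gt0 ?J.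
pose lo' (i : 'I_(size cs).+1) : 'I_(size cs).+2 := widen_ord (leqnSn _) i.
have /choice[xi xiP] (i : 'I_(size cs).+1) :
    exists z, x (lo' i) < z < x (lift ord0 i) /\
      powsum (fun j => w j * (c - y j)) y (r - 1) z = 0.
  have lx : x (lo' i) < x (lift ord0 i) by apply: xh; rewrite lift0 /=.
  have [z zI] := M _ _ (xJ _) (xJ _) lx.
  rewrite !fx !mul0r subrr => /esym/eqP; rewrite !mulf_eq0 oppr_eq0 mulf_eq0.
  have zJ : lo <= z <= hi.
    have /andP[a _] := xJ (lo' i); have /andP[_ b] := xJ (lift ord0 i).
    by case/andP: zI => /ltW? /ltW?; rewrite (le_trans a)// (le_trans _ b).
  by rewrite (negbTE r0) (negbTE (pc _ _ zJ))/= subr_eq0 (gt_eqF lx) orbF => /eqP; exists z.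
have xiJ j : lo <= xi j <= hi.
  have [/andP[a b] _] := xiP j; have /andP[a' _] := xJ (lo' j).
  have /andP[_ b'] := xJ (lift ord0 j).
  by rewrite (le_trans a' (ltW a)) (le_trans (ltW b) b').
have xih : {homo xi : i j / (i < j)%N >-> i < j}.
  move=> i j ij; have [/andP[_ a] _] := xiP i; have [/andP[b _] _] := xiP j.
  apply: lt_trans a _; apply: le_lt_trans b.
  have [e|e] := eqVneq (lift ord0 i) (lo' j); first by rewrite e.
  apply/ltW/xh; rewrite lift0 /= ltn_neqAle ij andbT.
  by apply: contra e => /eqP e; apply/eqP/val_inj.
have {}IH := IH _ xi (r - 1) xiJ csJ' xih _ (fun i => proj2 (xiP i)).
have {}IH : forall z, lo <= z <= hi ->
    powsum (fun j => w j * (c - y j)) y (r - 1) z = 0.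
  by apply: IH => j; have := ws j; rewrite big_cons mulrA.
move=> z zJ.
suff : powsum w y r z * (1 + z * c) `^ (- r) = 0.
  by move/eqP; rewrite mulf_eq0 (negbTE (pc _ _ zJ)) orbF => /eqP.
(* The derivative vanishes identically by induction, so the quotient is constant, and it is zero at
   [x ord0]. *)
have const a b : lo <= a <= hi -> lo <= b <= hi -> a < b ->
    powsum w y r b * (1 + b * c) `^ (- r) = powsum w y r a * (1 + a * c) `^ (- r).
  move=> aJ bJ ab; have [v /andP[av vb] /eqP] := M _ _ aJ bJ ab.
  rewrite IH ?mulr0 ?mul0r ?subr_eq0; first by move/eqP.
  by case/andP: aJ bJ => ? _ /andP[_ ?]; rewrite (le_trans _ (ltW av))// (le_trans (ltW vb)).
have x0J := xJ ord0.
case: (ltgtP z (x ord0)) => [h|h|->].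
- by rewrite -(const _ _ zJ x0J h) fx mul0r.
- by rewrite (const _ _ x0J zJ h) fx mul0r.
- by rewrite fx mul0r.
Qed.

(** * Sign changes and eigenvectors *)

(** The list is built from its right end, with [m] the first point where f is nonzero. A point y put
    in front gets a new cut, a zero of f between y and m, exactly when f y and f m have opposite
    signs. The last clause is shaped for [powsum_Descartes]. *)
Lemma sign_cuts (R : realType) (f : R -> R) (lo hi : R) (ys : seq R) :
  (forall a b, lo <= a <= hi -> lo <= b <= hi -> a < b -> f a * f b < 0 ->
     exists2 z, a < z < b & f z = 0) ->
  {in ys, forall y, lo <= y <= hi} -> sorted <%R ys ->
  {in ys, forall y, f y = 0} \/
  exists m cs, [/\ m \in ys, f m != 0 & {in ys, forall y, y < m -> f y = 0}] /\
   [/\ path <%R m cs, {in cs, forall c, lo <= c <= hi}, {in cs, forall c, f c = 0}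
    & {in ys, forall y, 0 <= f m * f y * \prod_(c <- cs) (c - y)}].
Proof.
move=> ivt; elim: ys => [|y ys IH]; first by left.
move=> ysJ /= p_ys.
have yJ : lo <= y <= hi by apply: ysJ; rewrite mem_head.
have ylt z : z \in ys -> y < z by move: p_ys => /(order_path_min lt_trans)/allP; apply.
have ysJ' : {in ys, forall y, lo <= y <= hi}.
  by move=> b bcs; apply: ysJ; rewrite inE bcs orbT.
have {IH} := IH ysJ' (path_sorted p_ys).
have [fy0|fy0] := eqVneq (f y) 0.
  case=> [f0|[m [cs [[mys fm ltm] [pm csJ csf sgn]]]]].
    by left=> z; rewrite inE => /predU1P[->|/f0].
  right; exists m, cs; split; split => //.
  - by rewrite inE mys orbT.
  - by move=> z; rewrite inE => /predU1P[->|/ltm].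
  - move=> z; rewrite inE => /predU1P[->|/sgn//].
    by rewrite fy0 mulr0 mul0r.
case=> [f0|[m [cs [[mys fm ltm] [pm csJ csf sgn]]]]].
  right; exists y, [::]; split; split => //.
  - by rewrite mem_head.
  - by move=> z; rewrite inE => /predU1P[->|/f0//]; rewrite ltxx.
  - move=> z; rewrite inE big_nil mulr1 => /predU1P[->|/f0->]; last by rewrite mulr0.
    by rewrite -expr2 sqr_ge0.
have ym := ylt _ mys; have mJ := ysJ' _ mys.
have mlt c : c \in cs -> m < c.
  by move: pm => /(order_path_min lt_trans)/allP; apply.
have fm2 : 0 < f m ^+ 2 by rewrite exprn_even_gt0.
have prod_ge0 : 0 <= \prod_(c <- cs) (c - y).
  rewrite big_seq; apply: prodr_ge0 => c /mlt mc.
  by rewrite subr_ge0 ltW// (lt_trans ym).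
right; have [lt0|ge0] := ltP (f y * f m) 0.
  have [z /andP[yz zm] fz] := ivt _ _ yJ mJ ym lt0.
  exists y, (z :: cs); split; split => //.
  - by rewrite mem_head.
  - move=> x; rewrite inE => /predU1P[->|/ylt yx]; first by rewrite ltxx.
    by move/(lt_trans yx); rewrite ltxx.
  - rewrite /= yz; move: pm; case: (cs) => //= c s /andP[mc ->].
    by rewrite (lt_trans zm).
  - move=> c; rewrite inE => /predU1P[->|/csJ//].
    have /andP[? _] := yJ; have /andP[_ ?] := mJ.
    by rewrite (le_trans _ (ltW yz))// (le_trans (ltW zm)).
  - by move=> c; rewrite inE => /predU1P[->|/csf].
  - move=> x; rewrite inE big_cons => /predU1P[->|xys].
      by rewrite -expr2 mulr_ge0 ?sqr_ge0// mulr_ge0// subr_ge0 ltW.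
    have [xm|mx] := ltP x m; first by rewrite (ltm _ xys xm) mulr0 mul0r.
    (* Multiplying by [f m ^+ 2] exposes the old invariant at x; the two other factors are
       nonnegative because f y and f m have opposite signs and x lies to the right of z. *)
    rewrite -(pmulr_rge0 _ fm2).
    have -> : f m ^+ 2 * (f y * f x * ((z - x) * \prod_(j <- cs) (j - x))) =
      (- (f y * f m)) * (x - z) * (f m * f x * \prod_(c <- cs) (c - x)) by ring.
    apply: mulr_ge0; last exact: sgn.
    apply: mulr_ge0; first by rewrite oppr_ge0 ltW.
    by rewrite subr_ge0 (le_trans (ltW zm)).
exists y, cs; split; split => //.
- by rewrite mem_head.
- move=> x; rewrite inE => /predU1P[->|/ylt yx]; first by rewrite ltxx.
  by move/(lt_trans yx); rewrite ltxx.
- by move: pm; case: (cs) => //= c s /andP[mc ->]; rewrite (lt_trans ym).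
- move=> x; rewrite inE => /predU1P[->|xys].
    by rewrite -expr2 mulr_ge0 ?sqr_ge0.
  rewrite -(pmulr_rge0 _ fm2).
  have -> : f m ^+ 2 * (f y * f x * \prod_(j <- cs) (j - x)) =
    (f y * f m) * (f m * f x * \prod_(c <- cs) (c - x)) by ring.
  by rewrite mulr_ge0// sgn.
Qed.

Lemma powsum_IVT (R : realType) (lo hi : R) (p : nat) (w y : 'I_p -> R) (r : R) :
  posdom lo hi -> (forall j, lo <= y j <= hi) ->
  forall a b, lo <= a <= hi -> lo <= b <= hi -> a < b ->
  powsum w y r a * powsum w y r b < 0 ->
  exists2 z, a < z < b & powsum w y r z = 0.
Proof.
move=> J yJ a b /andP[aJ _] /andP[_ bJ] ab.
set f := powsum w y r => fab.
have [||z] := @IVT _ f a b 0 (ltW ab).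
- apply: derivable_within_continuous => x; rewrite in_itv /= => /andP[ax xb].
  have xJ : lo <= x <= hi by rewrite (le_trans aJ ax) (le_trans xb).
  (* Continuity comes from the quotient rule with c = 0, where the divisor is 1. *)
  have d : is_derive x 1 (fun z => powsum w y r z * (1 + z * 0) `^ (- r))
      (r * (1 + x * 0) `^ (- r - 1) * powsum (fun j => w j * (y j - 0)) y (r - 1) x).
    by apply: is_derive_powsum_quot => [|j]; rewrite ?mulr0 ?addr0// J.
  have <- : (fun z => powsum w y r z * (1 + z * 0) `^ (- r)) = f.
    by apply/funext => z; rewrite mulr0 addr0 powR1 mulr1.
  exact: ex_derive.
- have [fa|fa|fa] := ltgtP (f a) 0.
  + have fb : 0 < f b by rewrite -(nmulr_rlt0 _ fa).
    have /ltW h := lt_trans fa fb.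
    by rewrite (min_idPl h) (max_idPr h) !ltW.
  + have fb : f b < 0 by rewrite -(pmulr_rlt0 _ fa).
    have /ltW h := lt_trans fb fa.
    by rewrite (min_idPr h) (max_idPl h) !ltW.
  + by move: fab; rewrite fa mul0r ltxx.
rewrite in_itv /= => /andP[az zb] fz; exists z => //.
have na : f a != 0 by apply: contraTneq fab => ->; rewrite mul0r ltxx.
have nb : f b != 0 by apply: contraTneq fab => ->; rewrite mulr0 ltxx.
rewrite !lt_neqAle az zb !andbT; apply/andP; split.
  by apply: contra_eq_neq fz => <-.
by apply: contra_eq_neq fz => ->.
Qed.

(** The positive weights [l] do not affect signs, so along the nodes w and the sum change sign
    together, whatever the sign of a. *)
Lemma powsum_eigenvector (R : realType) (lo hi : R) (p : nat)
    (w y l : 'I_p.+1 -> R) (r a : R) :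
  posdom lo hi -> (forall j, lo <= y j <= hi) ->
  {homo y : i j / (i < j)%N >-> i < j} ->
  a != 0 -> (forall j, 0 < l j) ->
  (forall j, powsum w y r (y j) = a * l j * w j) ->
  w ord0 = 0 -> forall j, w j = 0.
Proof.
move=> J yJ yh a0 l0 fw w0.
have wf j : powsum w y r (y j) = 0 -> w j = 0.
  by rewrite fw => /eqP; rewrite !mulf_eq0 (negbTE a0) (gt_eqF (l0 j))/= => /eqP.
set f := powsum w y r in fw wf.
pose ys := [seq y j | j <- enum 'I_p.+1].
have ysP z : z \in ys -> exists j, z = y j by case/mapP => j _ ->; exists j.
have yys j : y j \in ys by apply: map_f; rewrite mem_enum.
have ysJ : {in ys, forall z, lo <= z <= hi} by move=> z /ysP[j ->].
have ys_sorted : sorted <%R ys.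
  rewrite sorted_map; apply: (@sub_sorted _ (relpre val ltn)) => [i j|]; first exact: yh.
  by rewrite -sorted_map val_enum_ord iota_ltn_sorted.
have [f0|] := sign_cuts (@powsum_IVT _ lo hi _ w y r J yJ) ysJ ys_sorted.
  by move=> j; apply/wf/f0.
case=> m [cs [[mys fm _] [pm csJ csf sgn]]].
have [jm mE] := ysP _ mys.
(* Lying to the left of all cuts, [y ord0] is one zero more than the rule of signs allows. *)
pose zs := y ord0 :: cs.
have zs_sorted : sorted <%R zs.
  have y0m : y ord0 <= m.
    by rewrite mE; case: (eqVneq jm ord0) => [->//|n0]; rewrite ltW// yh// lt0n.
  by rewrite /= ; case: (cs) pm => //= c s /andP[mc ->]; rewrite (le_lt_trans y0m).
have : f m = 0; last by move/eqP; rewrite (negbTE fm).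
have s0 : f m * a != 0 by rewrite mulf_neq0.
apply: (mulfI s0); rewrite mulr0 -powsumZ.
pose x (i : 'I_(size cs).+1) := nth 0 zs i.
have xzs i : x i \in zs by apply: mem_nth; case: i.
apply: (@powsum_Descartes _ lo hi _ y cs _ x) => //.
- move=> i; have := xzs i; rewrite inE => /predU1P[->//|]; exact: csJ.
- move=> i j ij; rewrite /x (sorted_ltn_nth lt_trans 0 zs_sorted)// inE.
    exact: ltn_ord i.
  exact: ltn_ord j.
- move=> j; have := sgn _ (yys j); rewrite -/f fw.
  have -> : f m * (a * l j * w j) * \prod_(c <- cs) (c - y j) =
    l j * (f m * a * w j * \prod_(c <- cs) (c - y j)) by ring.
  by rewrite pmulr_rge0.
- move=> i; rewrite powsumZ; have := xzs i; rewrite inE => /predU1P[->|/csf].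
    by rewrite -/f fw w0 !mulr0.
  by rewrite -/f => ->; rewrite mulr0.
- exact: ysJ.
Qed.

(** * Symmetric matrices and their inertia *)

Lemma symmetricmxP (R : fieldType) (n : nat) (M : 'M[R]_n) :
  reflect (M^T = M) (M \is symmetricmx).
Proof.
apply: (iffP (is_hermitianmxP _ _ _)); rewrite expr0 scale1r map_mx_id//.
Qed.

(** Over the complex extension M is Hermitian, hence unitarily diagonalisable with a real diagonal;
    its first entry is a root of the characteristic polynomial already in R. *)
Lemma sym_eigenvalue (R : rcfType) (n : nat) (M : 'M[R]_n.+1) : M^T = M ->
  exists a, eigenvalue M a.
Proof.
move=> Msym; pose N := map_mx (real_complex R) M.
have Nherm : N \is hermsymmx.
  apply: realsym_hermsym; first by apply/symmetricmxP; rewrite map_trmx Msym.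
  by apply/mxOverP => i j; rewrite mxE complex_real.
have /orthomx_spectralP NE := hermitian_normalmx Nherm.
have /mxOverP/(_ 0 0) := hermitian_spectral_diag_real Nherm.
set P := spectralmx N in NE; set d := spectral_diag N in NE * => dreal.
have Punit : P \in unitmx := spectral_unit _.
exists (complex.Re (d 0 0)).
rewrite eigenvalue_root_char -(fmorph_root (real_complex R)) map_char_poly.
rewrite -eigenvalue_root_char; have /= -> := RRe_real dreal.
apply/eigenvalueP; exists (row 0 P).
  rewrite -[map_mx _ _]/N.
  rewrite -row_mul NE !mulmxA mulmxV// mul1mx; apply/rowP => j.
  by rewrite mul_diag_mx !mxE.
apply/eqP => P0; have : row 0 P *m invmx P = 0 by rewrite P0 mul0mx.
rewrite -row_mul mulmxV// => /rowP/(_ 0); rewrite !mxE eqxx => /eqP.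
by rewrite oner_eq0.
Qed.

Lemma row_norm_eq0 (R : realDomainType) (n : nat) (v : 'rV[R]_n) :
  ((v *m v^T) 0 0 == 0) = (v == 0).
Proof.
apply/eqP/eqP => [|->]; last by rewrite mul0mx mxE.
have F0 i : 0 <= v 0 i * v^T i 0 by rewrite mxE -expr2 sqr_ge0.
rewrite mxE => /(psumr_eq0P (fun i _ => F0 i)) h; apply/rowP => j.
by have /eqP := h j isT; rewrite !mxE -expr2 sqrf_eq0 => /eqP.
Qed.

(** H is the Householder reflection exchanging v and the first basis vector e; [v = e] is set apart
    because then e - v = 0 gives no axis. *)
Lemma orthogonal_complete (R : rcfType) (n : nat) (v : 'rV[R]_n.+1) :
  v *m v^T = 1%:M ->
  exists2 H : 'M_n.+1, H *m H^T = 1%:M & row 0 H = v.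
Proof.
move=> v1; pose e : 'rV[R]_n.+1 := delta_mx 0 0.
have e1 : e *m e^T = 1%:M.
  by apply/matrixP => i j; rewrite trmx_delta mul_delta_mx !ord1 !mxE.
have [->|ve] := eqVneq v e.
  by exists 1%:M; rewrite ?trmx1 ?mul1mx// rowE mulmx1.
pose u := e - v; pose s : R := (u *m u^T) 0 0.
have s0 : s != 0 by rewrite /s row_norm_eq0 subr_eq0 eq_sym.
have uu : u *m u^T = s%:M by rewrite [LHS]mx11_scalar.
pose H := 1%:M - (2 / s) *: (u^T *m u).
have HT : H^T = H by rewrite /H linearB /= linearZ /= trmx_mul trmxK trmx1.
have uH : u *m H = - u.
  rewrite /H mulmxBr mulmx1 -scalemxAr mulmxA uu mul_scalar_mx scalerA divfK//.
  by rewrite scaler_nat mulr2n opprD addrA subrr add0r.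
exists H.
  rewrite HT {2}/H mulmxBr mulmx1 -scalemxAr mulmxA -{2}HT.
  rewrite -[H^T *m _]trmxK trmx_mul !trmxK uH linearN /= mulNmx scalerN opprK.
  by rewrite /H subrK.
rewrite rowE -/e.
have ev : e *m v^T = v *m e^T.
  rewrite -[RHS]trmxK trmx_mul trmxK; apply/matrixP => i j.
  by rewrite !ord1 [RHS]mxE.
(* As e and v are unit vectors, |e - v|^2 is twice the product of e and e - v, so the reflection
   subtracts exactly u from e. *)
have se : s%:M = (2 : R) *: (e *m u^T).
  rewrite -uu /u linearB /= mulmxBl !mulmxBr e1 v1 -ev.
  by rewrite opprB scaler_nat mulr2n.
rewrite /H mulmxBr mulmx1 -scalemxAr mulmxA.
have -> : e *m u^T = (s / 2)%:M.
  have two0 : 2 != 0 :> R by rewrite pnatr_eq0.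
  by apply: (scalerI two0); rewrite -se scale_scalar_mx mulrC divfK.
rewrite mul_scalar_mx scalerA mulrA divfK// divff ?pnatr_eq0// scale1r.
by rewrite /u opprB addrC subrK.
Qed.

(** Deflation: conjugation by an orthogonal matrix whose first row is a unit eigenvector leaves, by
    symmetry, a block diagonal matrix with a smaller symmetric block. *)
Lemma sym_spectral (R : rcfType) (n : nat) (M : 'M[R]_n) : M^T = M ->
  exists Q (d : 'rV_n), Q *m Q^T = 1%:M /\ M = Q^T *m diag_mx d *m Q.
Proof.
elim: n M => [|n IH] M Msym; first by exists 1%:M, 0; split; apply/matrixP => -[].
have [a /eigenvalueP[v0 v0M v0n]] := sym_eigenvalue Msym.
pose t := Num.sqrt ((v0 *m v0^T) 0 0).
have s0 : 0 < (v0 *m v0^T) 0 0.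
  rewrite lt_neqAle eq_sym row_norm_eq0 v0n mxE; apply: sumr_ge0 => i _.
  by rewrite mxE -expr2 sqr_ge0.
have t0 : t != 0 by rewrite sqrtr_eq0 -ltNge.
pose v := t^-1 *: v0.
have v1 : v *m v^T = 1%:M.
  rewrite /v linearZ /= -scalemxAl -scalemxAr scalerA [v0 *m _]mx11_scalar.
  rewrite scale_scalar_mx -[X in _ * X](sqr_sqrtr (ltW s0)) -/t expr2.
  by rewrite mulrA mulfVK// mulVf.
have vM : v *m M = a *: v by rewrite /v -scalemxAl v0M !scalerA mulrC.
have [H HH rH] := orthogonal_complete v1.
have HH' : H^T *m H = 1%:M by apply: mulmx1C.
have [N defN] : exists N : 'M[R]_(1 + n), N = H *m M *m H^T by exists (H *m M *m H^T).
have NT : N^T = N by rewrite defN !trmx_mul trmxK Msym mulmxA.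
have N0 j : N 0 j = a *+ (j == 0).
  have -> : N 0 j = row 0 N 0 j by rewrite [RHS]mxE.
  rewrite defN -mulmxA row_mul rH mulmxA vM -scalemxAl -rH -row_mul HH.
  by rewrite !mxE mulr_natr eq_sym.
have NE : N = block_mx a%:M 0 0 (drsubmx N).
  rewrite -[LHS]submxK; congr block_mx.
  - by apply/matrixP => i j; rewrite !ord1 !mxE (lshift0, rshift1) N0 eqxx.
  - by apply/matrixP => i j; rewrite !ord1 !mxE (lshift0, rshift1) N0.
  - by apply/matrixP => i j; rewrite !ord1 -NT !mxE (lshift0, rshift1) N0.
have drT : (drsubmx N)^T = drsubmx N by rewrite trmx_drsub NT.
have [Q' [d' [Q'1 NQ]]] := IH _ drT.
pose Q : 'M[R]_(1 + n) := block_mx 1%:M 0 0 Q'.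
have Q1 : Q *m Q^T = 1%:M.
  rewrite /Q tr_block_mx !trmx0 trmx1 mulmx_block !mulmx0 !mul0mx mulmx1 Q'1.
  by rewrite !addr0 add0r -scalar_mx_block.
exists (Q *m H), (row_mx a%:M d').
split; first by rewrite trmx_mul mulmxA -[Q *m H *m _]mulmxA HH mulmx1.
have QN : N = Q^T *m diag_mx (row_mx a%:M d') *m Q.
  rewrite /Q tr_block_mx !trmx0 trmx1 diag_mx_row !mulmx_block.
  rewrite !(mulmx0, mul0mx, addr0, add0r, mul1mx, mulmx1) -NQ.
  by rewrite {1}NE; congr block_mx; apply/matrixP => i j; rewrite !ord1 !mxE eqxx.
rewrite trmx_mul !mulmxA -[H^T *m _ *m _]mulmxA -[H^T *m _ *m _]mulmxA -QN.
by rewrite defN !mulmxA HH' mul1mx -mulmxA HH' mulmx1.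
Qed.

Lemma kernel_row (F : fieldType) (p q : nat) (A : 'M[F]_(p, q)) :
  (q < p)%N -> exists2 z : 'rV_p, z != 0 & z *m A = 0.
Proof.
move=> qp; have /rowV0Pn[z /sub_kermxP zA z0] : kermx A != 0.
  rewrite kermx_eq0; apply: contraL qp => /eqP <-.
  by rewrite -leqNgt rank_leq_col.
by exists z.
Qed.

Lemma mul_diag_congr (R : comNzRingType) (m n : nat) (B : 'M[R]_(m, n))
    (e : 'rV_m) (x : 'rV_n) :
  (x *m (B^T *m diag_mx e *m B) *m x^T) 0 0
  = \sum_l e 0 l * (x *m B^T) 0 l ^+ 2.
Proof.
have -> : x *m (B^T *m diag_mx e *m B) *m x^T
  = (x *m B^T) *m diag_mx e *m (x *m B^T)^T by rewrite trmx_mul trmxK !mulmxA.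
by rewrite mul_mx_diag mxE; apply: eq_bigr => l _; rewrite !mxE mulrAC -expr2 mulrC.
Qed.

(* Sylvester: the subspace where the first form is positive has the dimension on
   the left, and the second form is nonpositive on a subspace whose codimension
   is at most the right-hand side. *)
Lemma sylvester_le (R : realFieldType) (m n p : nat) (Q : 'M[R]_(p, n)) (d : 'rV_p)
    (B : 'M_(m, n)) (e : 'rV_m) :
  row_free Q -> Q^T *m diag_mx d *m Q = B^T *m diag_mx e *m B ->
  (#|[pred i | (0 < d 0 i)%R]| <= #|[pred l | (0 < e 0 l)%R]|)%N.
Proof.
move=> Qfree E; rewrite leqNgt; apply/negP => lt.
set P := [pred i | 0 < d 0 i] in lt; set S := [pred l | 0 < e 0 l] in lt.
(* [Z] and [C] select the coordinates with d > 0 and e > 0. The vector x built from z makes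
   [x *m Q^T] supported on P while [x *m B^T] vanishes on S. *)
pose Z : 'M[R]_(#|P|, p) := \matrix_(i, j) (enum_val i == j)%:R.
pose C : 'M[R]_(m, #|S|) := \matrix_(i, j) (i == enum_val j)%:R.
have [z z0 zA] := kernel_row (Z *m (pinvmx Q)^T *m B^T *m C) lt.
pose x := z *m Z *m (pinvmx Q)^T.
have xQ : x *m Q^T = z *m Z by rewrite -[LHS]mulmxA -trmx_mul mulmxVp// trmx1 mulmx1.
have zZ i : (z *m Z) 0 (enum_val i) = z 0 i.
  rewrite mxE (bigD1 i)//= mxE eqxx mulr1 big1 ?addr0// => k ki.
  by rewrite mxE (inj_eq enum_val_inj) (negbTE ki) mulr0.
have zZ0 j : j \notin P -> (z *m Z) 0 j = 0.
  move=> jP; rewrite mxE big1// => k _; rewrite mxE.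
  by case: eqP => [kj|]; rewrite ?mulr0//; move: jP; rewrite -kj enum_valP.
have xC l : l \in S -> (x *m B^T) 0 l = 0.
  move=> lS; have /rowP/(_ (enum_rank_in lS l)) := zA.
  have Cl k : C k (enum_rank_in lS l) = (k == l)%:R by rewrite mxE enum_rankK_in.
  rewrite !mulmxA -/x [(_ *m C) _ _]mxE (bigD1 l)//= Cl eqxx mulr1 big1 => [|k /negbTE kl].
    by rewrite addr0 => ->; rewrite mxE.
  by rewrite Cl kl mulr0.
have : 0 < (x *m (Q^T *m diag_mx d *m Q) *m x^T) 0 0.
  have [i zi] : exists i, z 0 i != 0.
    by apply/existsP; apply: contraNT z0 => /existsPn h; apply/eqP/rowP => i;
      rewrite mxE; have /negPn/eqP := h i.
  rewrite mul_diag_congr xQ (bigD1 (enum_val i))//= zZ; apply: ltr_wpDr.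
    apply: sumr_ge0 => j _; have [jP|/zZ0->] := boolP (j \in P).
      by rewrite mulr_ge0 ?sqr_ge0// ltW.
    by rewrite expr0n mulr0.
  by rewrite mulr_gt0 ?exprn_even_gt0//; exact: (enum_valP i).
rewrite E mul_diag_congr ltNge => /negP; apply; apply: sumr_le0 => l _.
have [/xC->|lS] := boolP (l \in S); first by rewrite expr0n mulr0.
by rewrite mulr_le0_ge0 ?sqr_ge0// leNgt.
Qed.

Lemma char_poly_spectral (R : comUnitRingType) (n : nat) (Q : 'M[R]_n)
    (d : 'rV_n) : Q *m Q^T = 1%:M ->
  char_poly (Q^T *m diag_mx d *m Q) = \prod_i ('X - (d 0 i)%:P).
Proof.
move=> Q1; have Q1' : Q^T *m Q = 1%:M by apply: mulmx1C.
have -> : \prod_i ('X - (d 0 i)%:P) = char_poly (diag_mx d).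
  rewrite char_poly_trig ?diag_mx_is_trig//; apply: eq_bigr => i _.
  by rewrite mxE eqxx.
rewrite /char_poly /char_poly_mx.
set D := diag_mx d; pose pQ := map_mx polyC Q.
have pQ1 : pQ^T *m pQ = 1%:M by rewrite /pQ map_trmx -map_mxM Q1' map_mx1.
have -> : 'X%:M - map_mx polyC (Q^T *m D *m Q)
  = pQ^T *m ('X%:M - map_mx polyC D) *m pQ.
  rewrite mulmxBr mulmxBl mul_mx_scalar -scalemxAl pQ1 scalemx1.
  by rewrite !map_mxM -map_trmx.
rewrite !det_mulmx mulrAC -det_mulmx pQ1 det1 mul1r//.
Qed.

Lemma eig_mult_spectral (R : realType) (n : nat) (M Q : 'M[R]_n) (d : 'rV_n)
    (a : R) : Q *m Q^T = 1%:M -> M = Q^T *m diag_mx d *m Q ->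
  eig_mult M a = #|[pred i | d 0 i == a]|.
Proof.
move=> Q1 ->; rewrite /eig_mult char_poly_spectral//.
have -> : \prod_i ('X - (d 0 i)%:P) =
    \prod_(y <- [seq d 0 i | i <- enum 'I_n]) ('X - y%:P).
  by rewrite big_map big_enum.
by rewrite mu_prod_XsubC count_map -sum1_count big_enum_cond -sum1_card.
Qed.

Lemma sum_eig_mult (R : realType) (n : nat) (M Q : 'M[R]_n) (d : 'rV_n)
    (P : pred R) : Q *m Q^T = 1%:M -> M = Q^T *m diag_mx d *m Q ->
  (\sum_(x <- rootsR (char_poly M) | P x) eig_mult M x)%N
  = #|[pred i | P (d 0 i)]|.
Proof.
move=> Q1 ME; set s := rootsR _.
have s_uniq : uniq s by exact: uniq_roots.
have ds i : d 0 i \in s.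
  rewrite -roots_on_rootsR ?monic_neq0 ?char_poly_monic// inE /=.
  rewrite ME char_poly_spectral// /root horner_prod (bigD1 i)//=.
  by rewrite hornerXsubC subrr mul0r.
under eq_bigr do rewrite (eig_mult_spectral _ Q1 ME) -sum1_card big_mkcond.
rewrite exchange_big -sum1_card [RHS]big_mkcond /=; apply: eq_bigr => i _.
have [Pi|Pi] := boolP (P (d 0 i)); last first.
  rewrite inE (negbTE Pi) big1// => x Px; rewrite inE.
  by case: eqP => // dx; rewrite dx Px in Pi.
rewrite inE Pi big_mkcond (bigD1_seq (d 0 i))//= Pi inE eqxx big1 ?addn0// => x xd.
by rewrite inE eq_sym (negbTE xd); case: (P x).
Qed.

(** M is compared with its spectral form by [sylvester_le] in both directions, then again after a
    change of sign; the zero eigenvalues are what remains of n. *)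
Lemma inertia_congr (R : realType) (m n : nat) (M : 'M[R]_n) (B : 'M_(m, n))
    (e : 'rV_m) :
  M = B^T *m diag_mx e *m B -> row_free B -> (forall l, e 0 l != 0) ->
  \rank M = m /\
  inertia M = (#|[pred l | (0 < e 0 l)%R]|, (n - m)%N, #|[pred l | (e 0 l < 0)%R]|).
Proof.
move=> ME Bfree e0.
have MT : M^T = M by rewrite ME !trmx_mul trmxK tr_diag_mx mulmxA.
have [Q [d [Q1 MQ]]] := sym_spectral MT.
have Qfree : row_free Q by rewrite row_free_unit; case/mulmx1_unit: Q1.
have pos_neg k (f : 'rV[R]_k) : #|[pred l | (0 < (- f) 0 l)%R]| = #|[pred l | (f 0 l < 0)%R]|.
  by apply: eq_card => l; rewrite !inE mxE oppr_gt0.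
have split3 k (f : 'rV[R]_k) : (#|[pred l | (0 < f 0 l)%R]| + #|[pred l | (f 0 l == 0)%R]|
     + #|[pred l | (f 0 l < 0)%R]| = k)%N.
  rewrite -[RHS](card_ord k) -!sum1_card. 
  rewrite [X in (X + _ + _)%N]big_mkcond [X in (_ + X + _)%N]big_mkcond.
  rewrite [X in (_ + _ + X)%N]big_mkcond -!big_split /=.
  by apply: eq_bigr => l _; rewrite !inE; case: ltgtP.
have QB : Q^T *m diag_mx d *m Q = B^T *m diag_mx e *m B by rewrite -MQ -ME.
have QBN : Q^T *m diag_mx (- d) *m Q = B^T *m diag_mx (- e) *m B.
  have diagN k (f : 'rV[R]_k) : diag_mx (- f) = - diag_mx f by rewrite linearN.
  by rewrite !diagN !mulmxN !mulNmx QB.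
have eq_pos : #|[pred i | (0 < d 0 i)%R]| = #|[pred l | (0 < e 0 l)%R]|.
  by apply/eqP; rewrite eqn_leq (sylvester_le Qfree QB) (sylvester_le Bfree (esym QB)).
have eq_neg : #|[pred i | (d 0 i < 0)%R]| = #|[pred l | (e 0 l < 0)%R]|.
  apply/eqP; rewrite -!pos_neg.
  by rewrite eqn_leq (sylvester_le Qfree QBN) (sylvester_le Bfree (esym QBN)).
have rM : \rank M = m.
  rewrite ME mxrankMfree// -mxrank_tr trmx_mul trmxK tr_diag_mx mxrankMfree//.
  by apply/mxrank_unit; rewrite unitmxE det_diag unitfE; apply/prodf_neq0.
have e00 : #|[pred l | (e 0 l == 0)%R]| = 0%N.
  by apply: eq_card0 => l; rewrite !inE (negbTE (e0 l)).
have := split3 _ d; have := split3 _ e; rewrite e00.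
move=> se sd; split => //; rewrite /inertia /n_pos /n_neg /n_zero.
rewrite (eig_mult_spectral _ Q1 MQ) !(sum_eig_mult _ Q1 MQ).
congr (_, _, _); [exact: eq_pos | | exact: eq_neg].
by rewrite -se -[X in (X - _)%N]sd eq_pos eq_neg addn0 addnAC addKn.
Qed.

Lemma row_free_ker (F : fieldType) (m n : nat) (A : 'M[F]_(m, n)) :
  (forall z : 'rV_m, z *m A = 0 -> z = 0) -> row_free A.
Proof.
move=> h; rewrite -kermx_eq0; apply/negPn/negP => /rowV0Pn[z /sub_kermxP zA].
by rewrite (h _ zA) eqxx.
Qed.

(** Multiplicity at least two gives two independent eigenvectors, rows of Q, and some nonzero
    combination of them is orthogonal to f. *)
Lemma double_eigenvector (R : realType) (n : nat) (M : 'M[R]_n) (a : R)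
    (f : 'cV_n) :
  M^T = M -> eigenvalue M a -> eig_mult M a != 1%N ->
  exists v : 'rV_n, [/\ v != 0, v *m M = a *: v & v *m f = 0].
Proof.
move=> MT; have [Q [d [Q1 MQ]]] := sym_spectral MT.
rewrite eigenvalue_root_char (eig_mult_spectral _ Q1 MQ).
rewrite {1}MQ char_poly_spectral// rootE horner_prod => /prodf_eq0[i _].
rewrite hornerXsubC subr_eq0 => /eqP ai card1.
have [j /andP[ji /eqP dj]] : exists j, (j != i) && (d 0 j == a).
  apply/existsP; apply: contraNT card1 => /existsPn h.
  apply/eqP/(@eq_card1 _ i) => j; rewrite !inE; have := h j.
  by case: eqVneq => [-> _|_ /negbTE//]; rewrite ai eqxx.
pose e k : 'rV[R]_n := delta_mx 0 k.
have eM k : d 0 k = a -> e k *m Q *m M = a *: (e k *m Q).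
  move=> dk; rewrite MQ !mulmxA -[e k *m Q *m _]mulmxA Q1 mulmx1 scalemxAl.
  congr (_ *m _); apply/rowP => l; rewrite mul_mx_diag !mxE eqxx /=.
  by case: eqP => [->|_]; [rewrite dk mulrC | rewrite mul0r mulr0].
have eQ0 (u : 'rV_n) : u != 0 -> u *m Q != 0.
  apply: contra => /eqP uQ; apply/eqP.
  by rewrite -[u]mulmx1 -Q1 mulmxA uQ mul0mx.
have [b fi] : exists b, e i *m Q *m f = b%:M by exists ((e i *m Q *m f) 0 0); exact: mx11_scalar.
have [c fj] : exists b, e j *m Q *m f = b%:M by exists ((e j *m Q *m f) 0 0); exact: mx11_scalar.
have [b0|b0] := eqVneq b 0.
  exists (e i *m Q); split; [apply: eQ0 | by rewrite eM | by rewrite fi b0 raddf0].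
  by apply/eqP => /rowP/(_ i); rewrite !mxE !eqxx; apply/eqP/oner_neq0.
exists ((c *: e i - b *: e j) *m Q); split.
- apply/eQ0/eqP => /rowP/(_ j); rewrite !mxE !eqxx (negbTE ji) /= mulr0 mulr1 add0r.
  by apply/eqP; rewrite oppr_eq0.
- by rewrite !mulmxBl -!scalemxAl !eM// scalerBr !scalerA ![a * _]mulrC.
- by rewrite !mulmxBl -!scalemxAl fi fj !scale_scalar_mx mulrC subrr.
Qed.

(** A row vector in the kernel holds the coefficients of a polynomial of degree less than m with k
    >= m distinct roots. *)
Lemma Vandermonde_row_free (F : fieldType) (m k : nat) (y : 'rV[F]_k) :
  injective (y 0) -> (m <= k)%N -> row_free (Vandermonde m y).
Proof.
case: m => [|m] yinj mk; first by rewrite /row_free flatmx0 mxrank0.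
apply: row_free_ker => z zV.
pose p := \poly_(l < m.+1) z 0 (inord l).
have p0 : p = 0.
  apply/eqP/negPn/negP => pn0.
  have := max_poly_roots (rs := [seq y 0 j | j <- enum 'I_k]) pn0.
  rewrite map_inj_uniq// enum_uniq size_map size_enum_ord => /(_ _ isT).
  have -> : all (root p) [seq y 0 j | j <- enum 'I_k].
    apply/allP => _ /mapP[j _ ->]; rewrite rootE horner_poly.
    apply/eqP; transitivity ((z *m Vandermonde m.+1 y) 0 j); last by rewrite zV mxE.
    by rewrite mxE; apply: eq_bigr => l _; rewrite mxE inord_val.
  by move=> /(_ isT) /leq_trans/(_ (size_poly _ _)); rewrite ltnNge mk.
apply/rowP => l; rewrite mxE.
by have := coef_poly m.+1 (fun l => z 0 (inord l)) l; rewrite -/p p0 coef0 ltn_ord inord_val.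
Qed.

(** * The matrix of powers of [1 + y i * y j] *)

Definition affine_powmx (R : realType) (k : nat) (y : 'I_k -> R) (r : R) : 'M[R]_k :=
  \matrix_(i, j) (1 + y i * y j) `^ r.

Lemma affine_powmx_sym (R : realType) (k : nat) (y : 'I_k -> R) (r : R) :
  (affine_powmx y r)^T = affine_powmx y r.
Proof. by apply/matrixP => i j; rewrite !mxE mulrC. Qed.

Lemma mul_affine_powmx (R : realType) (k : nat) (y : 'I_k -> R) (r : R)
    (w : 'rV_k) i :
  (w *m affine_powmx y r) 0 i = powsum (w 0) y r (y i).
Proof. by rewrite mxE; apply: eq_bigr => j _; rewrite mxE [y j * _]mulrC. Qed.

Lemma affine_powmx_nat (R : realType) (k : nat) (y : 'I_k -> R) (q : nat) :
  (forall i j, 0 < 1 + y i * y j) ->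
  let V := Vandermonde q.+1 (\row_j y j) in
  affine_powmx y q%:R = V^T *m diag_mx (\row_l 'C(q, l)%:R) *m V.
Proof.
move=> ypos V; apply/matrixP => i j; rewrite mul_mx_diag !mxE powR_mulrn ?ltW//.
rewrite exprDn; apply: eq_bigr => l _.
by rewrite !mxE expr1n mul1r exprMn -mulr_natr mulrAC.
Qed.

(** The coefficient vectors form a lower triangular W for which [W *m K] is upper triangular, so
    [W *m K *m W^T] is upper triangular and, by symmetry, diagonal. The signs of its entries come
    from [powsum_sign]. *)
Lemma affine_powmx_LDL (R : realType) (lo hi : R) (k : nat) (y : 'I_k -> R) (r : R) :
  posdom lo hi -> (forall j, lo <= y j <= hi) ->
  {homo y : i j / (i < j)%N >-> i < j} ->
  (forall p, (p < k)%N -> falling r p != 0) ->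
  exists L (e : 'rV_k),
    [/\ L \in unitmx, affine_powmx y r = L^T *m diag_mx e *m L
      & forall l : 'I_k, 0 < e 0 l * falling r l].
Proof.
move=> J yJ yh ff0; set K := affine_powmx y r.
have /choice[w wP] (p : 'I_k) : exists w : 'rV[R]_k,
    [/\ forall j : 'I_k, (p < j)%N -> w 0 j = 0,
        forall i : 'I_k, (i < p)%N -> (w *m K) 0 i = 0
      & 0 < w 0 p * (w *m K) 0 p * falling r p].
  pose emb : 'I_p.+1 -> 'I_k := widen_ord (ltn_ord p).
  (* There are p vanishing conditions on p + 1 coefficients, so a nonzero solution exists. *)
  pose A : 'M[R]_(p.+1, p) :=
    \matrix_(i, j) (1 + y (emb (widen_ord (leqnSn p) j)) * y (emb i)) `^ r.
  have [z z0 zA] := kernel_row A (ltnSn p).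
  pose w : 'rV[R]_k := \row_j if (j < p.+1)%N then z 0 (inord j) else 0.
  have wemb i : w 0 (emb i) = z 0 i by rewrite mxE /= ltn_ord inord_val.
  have wK i : (w *m K) 0 i = powsum (z 0) (y \o emb) r (y i).
    rewrite mul_affine_powmx /powsum (bigID (fun j : 'I_k => (j < p.+1)%N))/=.
    rewrite [X in _ + X]big1 ?addr0.
      by rewrite (big_ord_narrow (ltn_ord p)); apply: eq_bigr => j _; rewrite wemb.
    by move=> j /negbTE jp; rewrite mxE jp mul0r.
  have embm : emb ord_max = p by exact: val_inj.
  have wK0 (i : 'I_p.+1) : (i < p)%N -> powsum (z 0) (y \o emb) r (y (emb i)) = 0.
    move=> ip; transitivity ((z *m A) 0 (Ordinal ip)); last by rewrite zA mxE.
    rewrite mxE; apply: eq_bigr => j _; rewrite mxE; congr (_ * (1 + y _ * _) `^ r).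
    exact: val_inj.
  exists w; split.
  - by move=> j pj; rewrite mxE ltnNge pj.
  - move=> i ip; have ip' : (i < p.+1)%N by exact: ltnW.
    have -> : i = emb (Ordinal ip') by exact: val_inj.
    by rewrite wK wK0.
  - have -> : w 0 p = z 0 ord_max by rewrite -wemb embm.
    have -> : (w *m K) 0 p = powsum (z 0) (y \o emb) r ((y \o emb) ord_max).
      by rewrite wK /= embm.
    apply: (powsum_sign (x := y \o emb) J) => //=.
    + by move=> i j ij; exact: yh.
    + by move=> i j ij; exact: yh.
    + exact: ff0.
    + apply/existsP; apply: contraNT z0 => /existsPn h; apply/eqP/rowP => i.
      by rewrite mxE; have /negPn/eqP := h i.
pose W : 'M[R]_k := \matrix_p w p.
have Wu : W \in unitmx.
  rewrite unitmxE det_trig.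
    rewrite unitfE; apply/prodf_neq0 => p _; rewrite mxE.
    have [_ _] := wP p; apply: contraTneq => ->.
    by rewrite !mul0r ltxx.
  by apply/is_trig_mxP => i j ij; rewrite mxE; have [h _ _] := wP i; exact: h.
pose e : 'rV_k := \row_p (w p 0 p * (w p *m K) 0 p).
have WKW : W *m K *m W^T = diag_mx e.
  have WK p i : (W *m K) p i = (w p *m K) 0 i.
    rewrite -[w p](rowK w p). by rewrite -row_mul [RHS]mxE.
  have E (p q : 'I_k) : (q <= p)%N -> (W *m K *m W^T) p q = diag_mx e p q.
    move=> qp; rewrite mxE (bigD1 p)//= big1 => [|i ip].
      rewrite addr0 WK !mxE mulrC; have [->|pq] := eqVneq p q; first by [].
      by have [h _ _] := wP q; rewrite h ?mul0r// ltn_neqAle eq_sym pq.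
    rewrite WK [W^T _ _]mxE [W _ _]mxE; have [h1 h2 _] := wP p; have [h3 _ _] := wP q.
    have [lt|gt|e'] := ltngtP i p; first by rewrite h2 ?mul0r.
      by rewrite h3 ?mulr0// (leq_ltn_trans qp).
    by move: ip; rewrite (val_inj e') eqxx.
  apply/matrixP => p q; case: (leqP q p) => [/E//|/ltnW/E].
  have WT : (W *m K *m W^T)^T = W *m K *m W^T.
    by rewrite !trmx_mul trmxK affine_powmx_sym mulmxA.
  by rewrite -{1}WT [LHS]mxE => ->; rewrite -[in RHS]tr_diag_mx [RHS]mxE.
exists (invmx W)^T, e; split.
- by rewrite unitmx_tr unitmx_inv.
- by rewrite trmxK -WKW !mulmxA mulVmx// mul1mx -mulmxA -trmx_mul mulVmx// trmx1 mulmx1.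
- by move=> l; rewrite mxE; have [] := wP l.
Qed.

(** * Rank two positive semidefinite matrices *)

(** The Schur complement S of a diagonal entry has rank one and a nonnegative diagonal, so
    [S i j = b i * b j]. The part split off is [a i * a j], and t is b / a. *)
Lemma rank2_psd_decomp (R : realType) (n : nat) (A : 'M[R]_n) :
  psdmx A -> \rank A = 2%N -> (forall i j, 0 < A i j) ->
  exists a t : 'I_n -> R, (forall i, 0 < a i) /\
    forall i j, A i j = a i * a j * (1 + t i * t j).
Proof.
move=> [/symmetricmxP AT Apsd] rA Apos.
have symA i j : A i j = A j i by rewrite -{1}AT mxE.
have [o _] : exists o : 'I_n, true.
  by case: n A {AT Apsd Apos symA} rA => [A|n A _]; [rewrite flatmx0 mxrank0|exists ord0].
set s := A o o; have s0 : 0 < s := Apos o o.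
pose S := A - s^-1 *: (col o A *m row o A).
have SE i j : S i j = A i j - A i o * A o j / s.
  by rewrite !mxE big_ord1 !mxE mulrC.
have rS1 : \rank S = 1%N.
  apply/eqP; rewrite eqn_leq; apply/andP; split.
    rewrite -ltnS -rA; apply: rank_ltmx; rewrite ltmxE; apply/andP; split.
      rewrite addmx_sub ?submx_refl// -scaleNr scalemx_sub//.
      by apply: mulmx_sub; exact: row_sub.
    (* Column o of S is zero while [A o o] is positive, so the row space of A is not contained in
       that of S. *)
    apply/negP => /submxP[D AD].
    have : s = (D *m S) o o by rewrite -AD.
    rewrite mxE big1 => [s00|l _]; first by rewrite s00 ltxx in s0.
    by rewrite SE mulfK ?subrr ?mulr0// gt_eqF.
  have : (\rank A <= \rank S + 1)%N.
    have {1}-> : A = S + s^-1 *: (col o A *m row o A) by rewrite subrK.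
    apply: leq_trans (mxrank_add _ _) _; rewrite leq_add2l.
    apply: leq_trans (mxrank_scale _ _) _; apply: leq_trans (mxrankM_maxl _ _) _.
    exact: rank_leq_col.
  by rewrite rA addn1.
have [x [y Sxy]] : exists x y : 'I_n -> R, forall i j, S i j = x i * y j.
  move: (col_base S) (row_base S) (mulmx_base S); rewrite rS1 => c b cb.
  by exists (fun i => c i 0), (b 0) => i j; rewrite -cb mxE big_ord1.
have Sdiag i : 0 <= S i i; first rewrite SE.
  (* This test vector gives the form the value [S i i]. *)
  have := Apsd (delta_mx i 0 - (A i o / s) *: delta_mx o 0).
  rewrite [(_ - _)^T]linearB /= [(_ *: _)^T]linearZ /= !trmx_delta mulmxBl -scalemxAl -!rowE.
  rewrite !mulmxBr -!scalemxAr !mulmxBl -!scalemxAl -!colE !mxE.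
  rewrite -/s [A o i]symA divfK ?gt_eqF// subrr mulr0 subr0 mulrAC.
  by [].
have Ssym i j : S i j = S j i by rewrite !SE symA [A o j]symA [A i o]symA [X in _ - X / _]mulrC.
have [i1 xi1] : exists i, x i * y i != 0.
  apply/existsP; apply: contra_eqT rS1 => /existsPn h.
  suff -> : S = 0 by rewrite mxrank0.
  apply/matrixP => i j; rewrite [RHS]mxE; apply/eqP; rewrite -sqrf_eq0 expr2.
  have -> : S i j * S i j = x i * y i * (x j * y j) by rewrite {1}Ssym !Sxy; ring.
  by have /negPn/eqP -> := h i; rewrite mul0r.
have x0 : x i1 != 0 by apply: contraNneq xi1 => ->; rewrite mul0r.
have c0 : 0 <= y i1 / x i1.
  have -> : y i1 / x i1 = S i1 i1 / x i1 ^+ 2 by rewrite Sxy; field.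
  by rewrite divr_ge0 ?sqr_ge0.
(* By symmetry y is proportional to x; the ratio is nonnegative, so its square root can be shared
   between the two sides. *)
pose b i := Num.sqrt (y i1 / x i1) * x i.
have Sb i j : S i j = b i * b j.
  rewrite /b mulrACA -expr2 sqr_sqrtr//.
  have yj : y j = y i1 / x i1 * x j.
    apply: (mulfI x0); rewrite -Sxy Ssym Sxy; field; done.
  by rewrite Sxy yj; ring.
pose a i := A i o / Num.sqrt s.
have q0 : 0 < Num.sqrt s by rewrite sqrtr_gt0.
have a0 i : 0 < a i by rewrite divr_gt0.
exists a, (fun i => b i / a i); split=> // i j.
have -> : a i * a j * (1 + b i / a i * (b j / a j)) = a i * a j + b i * b j.
  by field; rewrite !gt_eqF.
rewrite -Sb SE /a mulf_div -expr2 sqr_sqrtr ?ltW// [A j o]symA.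
by rewrite addrC subrK.
Qed.

(** [cls] groups the indices by value, and [sect] picks a representative, so that no class is
    empty. *)
Lemma enum_values (R : realDomainType) (n : nat) (t : 'I_n -> R) :
  exists (k : nat) (y : 'I_k -> R) (cls : 'I_n -> 'I_k) (sect : 'I_k -> 'I_n),
    [/\ {homo y : i j / (i < j)%N >-> i < j}, forall i, t i = y (cls i)
      & cancel sect cls].
Proof.
pose s := sort <=%R (undup [seq t i | i <- enum 'I_n]).
have s_sorted : sorted <%R s.
  by rewrite lt_sorted_uniq_le sort_uniq undup_uniq sort_le_sorted.
have ts i : t i \in s by rewrite mem_sort mem_undup map_f ?mem_enum.
have tlt i : (index (t i) s < size s)%N by rewrite index_mem.
have sect p : exists i, t i = nth 0 s (p : 'I_(size s)).
  have : nth 0 s p \in s by rewrite mem_nth.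
  by rewrite mem_sort mem_undup => /mapP[i _ ->]; exists i.
have {sect}/choice[g gP] := sect.
exists (size s), (fun p => nth 0 s p), (fun i => Ordinal (tlt i)), g; split.
- by move=> i j ij; rewrite (sorted_ltn_nth lt_trans)// inE.
- by move=> i; rewrite /= nth_index.
- move=> p; apply: val_inj; rewrite /= gP index_uniq//.
  exact: lt_sorted_uniq s_sorted.
Qed.

(** Divided by [a l], a column is an affine function of [t l]; hence columns are proportional
    exactly when they lie in the same class, and [sect] yields a largest list. *)
Lemma hadamard_power_rank_values (R : realType) (n k : nat) (A : 'M[R]_n)
    (a t : 'I_n -> R) (y : 'I_k -> R) (cls : 'I_n -> 'I_k) (sect : 'I_k -> 'I_n) :
  (forall i, 0 < a i) -> (forall i j, A i j = a i * a j * (1 + t i * t j)) ->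
  injective y -> (forall i, t i = y (cls i)) -> cancel sect cls ->
  hadamard_power_rank A = k.
Proof.
move=> a0 AE yinj tE sectK.
have propP i j : (exists c, col i A = c *: col j A) <-> cls i = cls j.
  split=> [[c Ac]|ij].
    apply: yinj; rewrite -!tE.
    have E l : a i * (1 + t l * t i) = c * (a j * (1 + t l * t j)).
      have /colP/(_ l) := Ac; rewrite !mxE !AE => E.
      by apply: (mulfI (lt0r_neq0 (a0 l))); rewrite [LHS]mulrA E; ring.
    have [//|tij] := eqVneq (t i) (t j).
    (* Two affine functions agreeing at the distinct points [t i] and [t j] have equal slopes, and
       then equal constants. *)
    have D : (a i * t i - c * a j * t j) * (t i - t j) = 0.
      have -> : (a i * t i - c * a j * t j) * (t i - t j) =
       (a i * (1 + t i * t i) - c * (a j * (1 + t i * t j)))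
       - (a i * (1 + t j * t i) - c * (a j * (1 + t j * t j))) by ring.
      by rewrite !E !subrr.
    move/eqP: D; rewrite mulf_eq0 [X in _ || X]subr_eq0 (negbTE tij) orbF subr_eq0 => /eqP D.
    have ai : a i = c * a j.
      have := E i; rewrite !mulrDr !mulr1 => /eqP; rewrite -subr_eq0 => /eqP Z.
      apply/eqP; rewrite -subr_eq0; apply/eqP; rewrite -[RHS]Z.
      have -> : c * (a j * (t i * t j)) = c * a j * t j * t i by ring.
      by rewrite -D; ring.
    by move: D; rewrite -ai => /(mulfI (lt0r_neq0 (a0 i))).
  exists (a i / a j); apply/colP => l; rewrite !mxE !AE !tE ij; field.
  by rewrite gt_eqF.
apply/eqP; rewrite eqn_leq; apply/andP; split.
  apply/bigmax_leqP => S /asboolP Sind.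
  have inj : {in S &, injective cls}.
    move=> i j iS jS ij; apply/eqP/negPn/negP => nij.
    by apply: (Sind i j iS jS nij); apply/propP.
  by rewrite -(card_in_imset inj) -[X in (_ <= X)%N]card_ord max_card.
have kE : #|[set sect p | p : 'I_k]| = k.
  by rewrite card_imset ?card_ord//; exact: can_inj sectK.
have := @leq_bigmax_cond _ (fun S => `[< pairwise_nonproportional_cols A S >])
  (fun S => #|S|) [set sect p | p : 'I_k].
rewrite kE => h; apply: h.
apply/asboolP => _ _ /imsetP[p _ ->] /imsetP[q _ ->] pq /propP.
by rewrite !sectK => e; rewrite e eqxx in pq.
Qed.

(** If u and v have the same sign, [u * v] is nonnegative; otherwise it is at least [lo * hi]. *)
Lemma posdom_ends (R : realType) (lo hi : R) :
  0 < 1 + lo * hi -> posdom lo hi.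
Proof.
move=> h u v /andP[lu uh] /andP[lv vh].
have [u0|u0] := lerP u 0; have [v0|v0] := lerP v 0.
- by rewrite ltr_wpDr// mulr_le0.
- nra.
- nra.
- by rewrite ltr_wpDr// mulr_ge0// ltW.
Qed.

Lemma psd_congr (R : realType) (m n : nat) (M : 'M[R]_n) (B : 'M_(m, n))
    (e : 'rV_m) :
  M = B^T *m diag_mx e *m B -> (forall l, 0 <= e 0 l) -> psdmx M.
Proof.
move=> ME e0; split.
  by apply/symmetricmxP; rewrite ME !trmx_mul trmxK tr_diag_mx mulmxA.
move=> x; rewrite -{2}[x]trmxK ME mul_diag_congr; apply: sumr_ge0 => l _.
by rewrite mulr_ge0 ?sqr_ge0.
Qed.

(** * Signs of the pivots and simple eigenvalues *)

Lemma falling_gt0 (R : realType) (r : R) (l : nat) :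
  l%:R - 1 < r -> 0 < falling r l.
Proof.
move=> lr; apply: prodr_gt0 => i _; rewrite subr_gt0; apply: le_lt_trans lr.
by rewrite lerBrDr natr1 ler_nat.
Qed.

(** The factors r - l are positive for l <= m and negative from l = m + 1 on. *)
Lemma falling_sign (R : realType) (r : R) (m j : nat) :
  m%:R < r -> r < m.+1%:R -> 0 < (-1) ^+ j * falling r (m.+1 + j).
Proof.
move=> mr rm; elim: j => [|j IH].
  by rewrite expr0 mul1r addn0 falling_gt0// -natr1 addrK.
rewrite addnS /falling big_ord_recr /= -/(falling r _) exprS.
have -> : -1 * (-1) ^+ j * (falling r (m.+1 + j) * (r - (m.+1 + j)%:R))
  = ((-1) ^+ j * falling r (m.+1 + j)) * ((m.+1 + j)%:R - r) by ring.
rewrite mulr_gt0// subr_gt0 (lt_le_trans rm)// ler_nat leq_addr//.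
Qed.

(** The product for index l ends with r - (l - 1), so index m + 1 is still positive; from there on
    the signs alternate, hence the rounding up of the positive count. *)
Lemma card_falling_sign (R : realType) (r : R) (m c k : nat) (e : 'I_k -> R) :
  k = (m.+1 + c)%N -> m%:R < r -> r < m.+1%:R ->
  (forall l : 'I_k, 0 < e l * falling r l) ->
  #|[pred l | 0 < e l]| = (m.+1 + uphalf c)%N /\ #|[pred l | e l < 0]| = c./2.
Proof.
move=> kE; case: _ / (esym kE) in e * => mr rm ef.
have elo i : 0 < e (lshift c i).
  have := ef (lshift c i); rewrite pmulr_lgt0// falling_gt0//.
  by rewrite (le_lt_trans _ mr)// lerBlDr natr1 ler_nat ltnW//= ltn_ord.
have ehi (i : 'I_c) : 0 < (-1) ^+ i * e (rshift m.+1 i).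
  have := mulr_gt0 (ef (rshift m.+1 i)) (falling_sign i mr rm).
  rewrite /= => h; rewrite -(pmulr_lgt0 _ (_ : 0 < falling r (m.+1 + i) ^+ 2)).
    by move: h; congr (_ < _); ring.
  rewrite exprn_even_gt0//=; apply: contraTneq h => ->.
  by rewrite !mulr0 ltxx.
have sgnhi (i : 'I_c) : (0 < e (rshift m.+1 i)) = ~~ odd i /\ (e (rshift m.+1 i) < 0) = odd i.
  have := ehi i; rewrite -signr_odd; case: (odd i); rewrite ?expr1 ?expr0.
    by rewrite mulN1r oppr_gt0 => h; rewrite h ltNge ltW.
  by rewrite mul1r => h; rewrite h ltNge ltW.
split; rewrite -sum1_card big_mkcond big_split_ord /=.
  under eq_bigr do rewrite inE elo.
  rewrite sum1_card card_ord; under eq_bigr do rewrite inE (sgnhi _).1.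
  congr (_ + _)%N; elim: (c) => [|d IH]; first by rewrite big_ord0.
  rewrite big_ord_recr /= IH uphalf_half; case: (odd d) => /=.
    by rewrite addn0 add1n.
  by rewrite add0n addn1.
rewrite big1 => [|i _]; last by rewrite inE ltNge (ltW (elo _)).
rewrite add0n; under eq_bigr do rewrite inE (sgnhi _).2.
elim: (c) => [|d IH]; first by rewrite big_ord0.
by rewrite big_ord_recr /= IH uphalf_half; case: (odd d); rewrite ?addn1 ?addn0.
Qed.

Lemma falling_neq0 (R : realType) (r : R) (m l : nat) :
  m%:R < r -> r < m.+1%:R -> falling r l != 0.
Proof.
move=> mr rm; apply/prodf_neq0 => i _; rewrite subr_eq0.
have [im|mi] := leqP i m.
  by rewrite gt_eqF// (le_lt_trans _ mr)// ler_nat.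
by rewrite lt_eqF// (lt_le_trans rm)// ler_nat.
Qed.

Lemma affine_powmx_simple_eigenvalue (R : realType) (lo hi : R) (k n : nat)
    (y : 'I_k -> R) (r a : R) (W : 'M_(k, n)) (g : 'rV_k) (M : 'M_n) :
  posdom lo hi -> (forall j, lo <= y j <= hi) ->
  {homo y : i j / (i < j)%N >-> i < j} ->
  W *m W^T = diag_mx g -> (forall p, 0 < g 0 p) ->
  M = W^T *m affine_powmx y r *m W ->
  a != 0 -> eigenvalue M a -> eig_mult M a = 1%N.
Proof.
move=> J yJ yh WW g0 ME a0 Ma.
have MT : M^T = M by rewrite ME !trmx_mul trmxK affine_powmx_sym mulmxA.
case: k => [|k] in y W g yJ yh WW g0 ME *.
  case/eigenvalueP: Ma => v; rewrite ME [W]flatmx0 !mulmx0 => /esym/eqP.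
  by rewrite scaler_eq0 (negbTE a0) => /= ->.
apply/eqP; apply: contraT => mult.
(* Orthogonality to row 0 of W makes the first coordinate of [v *m W^T] vanish. *)
have [v [v0 vM vW0]] := double_eigenvector (row 0 W)^T MT Ma mult.
pose w := v *m W^T.
have w0 : w 0 0 = 0.
  transitivity ((v *m (row 0 W)^T) 0 0); last by rewrite vW0 mxE.
  by rewrite !mxE; apply: eq_bigr => j _; rewrite !mxE.
have wK : w *m affine_powmx y r *m diag_mx g = a *: w.
  by rewrite -WW /w scalemxAl -vM ME !mulmxA.
have w_eq0 : w = 0.
  apply/rowP => j; rewrite [RHS]mxE.
  apply: (powsum_eigenvector (w := w 0) (l := fun p => (g 0 p)^-1) J yJ yh a0) => // [p|p].
    by rewrite invr_gt0.
  have /rowP/(_ p) := wK; rewrite mul_mx_diag [LHS]mxE [RHS]mxE mul_affine_powmx => E.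
  by rewrite mulrAC -E mulfK// gt_eqF.
case/negP: v0; have : a *: v = 0 by rewrite -vM ME !mulmxA -/w w_eq0 !mul0mx.
by move/eqP; rewrite scaler_eq0 (negbTE a0).
Qed.

Theorem theorem2 (R : realType) (n : nat) (A : 'M[R]_n) (k : nat) (r : R)
  (A_psd : psdmx A)
  (A_rank2 : \rank A = 2%N)
  (A_pos : forall i j : 'I_n, 0 < A i j)
  (A_hpr : hadamard_power_rank A = k)
  (r_ge0 : 0 <= r) :
  [/\ (* (i) *)
      0 < r -> k%:R - 2 < r ->
        [/\ psdmx (hadamard_power A r),
            \rank (hadamard_power A r) = k
          & inertia (hadamard_power A r) = (k, n - k, 0)%N],
      (* (ii) *)
      forall q : nat, r = q%:R -> (q + 2 <= k)%N ->
        [/\ psdmx (hadamard_power A r),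
            \rank (hadamard_power A r) = q.+1
          & inertia (hadamard_power A r) = (q.+1, n - q - 1, 0)%N],
      (* (iii) *)
      forall m : nat, m%:R < r -> r < m.+1%:R -> (m + 1 <= k - 2)%N ->
        inertia (hadamard_power A r)
          = ((k + m + 2)./2, n - k, uphalf (k - m - 2))%N
    & (* (iv) *)
      forall a : R, a != 0 -> eigenvalue (hadamard_power A r) a ->
        eig_mult (hadamard_power A r) a = 1%N ].
Proof.
have [a [t [a0 AE]]] := rank2_psd_decomp A_psd A_rank2 A_pos.
have [k' [y [cls [sect [yh tE sectK]]]]] := enum_values t.
have yinj : injective y.
  move=> i j yij; apply/val_inj; case: (ltngtP i j) => // /yh.
    by rewrite yij ltxx.
  by rewrite yij ltxx.
have kE : k' = k by rewrite -A_hpr (hadamard_power_rank_values a0 AE yinj tE sectK).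
case: _ / kE; move: A_hpr => _.
have ty p : t (sect p) = y p by rewrite tE sectK.
have tpos i j : 0 < 1 + t i * t j.
  by have := A_pos i j; rewrite AE pmulr_rgt0// mulr_gt0.
have [lo [hi [J yJ]]] : exists lo hi, posdom lo hi /\ forall p, lo <= y p <= hi.
  case: k' => [|k'] in y cls sect yh tE sectK yinj ty *.
    by exists 0, 0; split=> [u v|[]//]; apply: posdom_ends; rewrite mul0r addr0.
  exists (y ord0), (y ord_max); split; first by apply: posdom_ends; rewrite -!ty.
  have yle (i j : 'I_k'.+1) : (i <= j)%N -> y i <= y j.
    rewrite leq_eqVlt => /predU1P[/val_inj->//|ij]; exact/ltW/yh.
  by move=> p; rewrite !yle// -ltnS.
(* Row p is the indicator of class p weighted by the powers of a; disjoint supports make the rows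
   orthogonal. *)
pose W : 'M[R]_(k', n) := \matrix_(p, i) ((a i) `^ r *+ (cls i == p)).
have ME : hadamard_power A r = W^T *m affine_powmx y r *m W.
  apply/matrixP => i j; rewrite !mxE (bigD1 (cls j))//= big1 => [|p pj].
    rewrite addr0 !mxE eqxx (bigD1 (cls i))//= big1 => [|q qi].
      rewrite !mxE eqxx addr0 AE !tE !powRM ?ltW ?mulr_gt0 -?tE//.
      by rewrite mulrAC.
    by rewrite !mxE eq_sym (negbTE qi) mul0r.
  by rewrite [W _ _]mxE eq_sym (negbTE pj) mulr0.
have Wfree : row_free W.
  apply: row_free_ker => z zW; apply/rowP => p.
  have /rowP/(_ (sect p)) := zW; rewrite mxE (bigD1 p)//= big1 => [|q qp].
    rewrite addr0 !mxE sectK eqxx => /eqP; rewrite mulf_eq0.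
    by rewrite [X in _ || X]gt_eqF ?orbF ?powR_gt0// => /eqP.
  by rewrite mxE sectK eq_sym (negbTE qp) mulr0.
have LDL : (forall p, (p < k')%N -> falling r p != 0) ->
  exists (B : 'M_(k', n)) (e : 'rV_k'),
   [/\ hadamard_power A r = B^T *m diag_mx e *m B, row_free B
      & forall l : 'I_k', 0 < e 0 l * falling r l].
  move=> ff0; have [L [e [Lu LE e0]]] := affine_powmx_LDL J yJ yh ff0.
  exists (L *m W), e; split => //; first by rewrite ME LE trmx_mul !mulmxA.
  by rewrite /row_free mxrankMfree// mxrank_unit.
have card_pos N (e : 'rV[R]_N) : (forall l, 0 < e 0 l) ->
    #|[pred l | 0 < e 0 l]| = N /\ #|[pred l | e 0 l < 0]| = 0%N.
  move=> e0; split; last by apply: eq_card0 => l; rewrite inE ltNge ltW.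
  by rewrite -[RHS]card_ord; apply: eq_card => l; rewrite inE e0.
split.
(* For p <= k - 1 every factor of [falling r p] is at least r - (k - 2) > 0, so all pivots are
   positive. *)
- move=> r0 kr.
  have falling_pos p : (p < k')%N -> 0 < falling r p.
    move=> pk; apply: falling_gt0; apply: le_lt_trans kr.
    by have : p.+1%:R <= k'%:R :> R; [rewrite ler_nat | rewrite -natr1; lra].
  have [p pk|B [e [ME' Bfree ef]]] := LDL.
    by rewrite gt_eqF// falling_pos.
  have e0 l : 0 < e 0 l.
    by have := ef l; rewrite pmulr_lgt0// falling_pos.
  have [rk In] := inertia_congr ME' Bfree (fun l => lt0r_neq0 (e0 l)).
  split => //; first by apply: (psd_congr ME') => l; exact: ltW.
  by rewrite In; have [-> ->] := card_pos _ _ e0.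
- move=> q rq qk.
  pose V := Vandermonde q.+1 (\row_j y j).
  have Vfree : row_free V.
    apply: Vandermonde_row_free; last by rewrite (leq_trans _ qk)// addn2.
    by move=> i j; rewrite !mxE; exact: yinj.
  have ypos i j : 0 < 1 + y i * y j by rewrite -!ty.
  have ME' : hadamard_power A r =
      (V *m W)^T *m diag_mx (\row_l 'C(q, l)%:R) *m (V *m W).
    by rewrite ME rq affine_powmx_nat// trmx_mul !mulmxA.
  have Bfree : row_free (V *m W) by rewrite /row_free mxrankMfree.
  have e0 l : 0 < (\row_l 'C(q, l)%:R : 'rV[R]_q.+1) 0 l.
    by rewrite mxE ltr0n bin_gt0 -ltnS.
  have [rk In] := inertia_congr ME' Bfree (fun l => lt0r_neq0 (e0 l)).
  split => //; first by apply: (psd_congr ME') => l; exact: ltW.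
  by rewrite In -subnDA addn1; have [-> ->] := card_pos _ _ e0.
- move=> m mr rm mk.
  have [p _|B [e [ME' Bfree ef]]] := LDL; first exact: falling_neq0 mr rm.
  have e0 l : e 0 l != 0.
    by apply: contraTneq (ef l) => ->; rewrite mul0r ltxx.
  have [_ ->] := inertia_congr ME' Bfree e0.
  (* With c = k - m - 1, the counts m + 1 + [uphalf c] and [c./2] are the stated ones; no
     subtraction truncates, since k >= m + 3. *)
  have kE : k' = (m.+1 + (k' - m.+1))%N by lia.
  have [-> ->] := card_falling_sign kE mr rm ef.
  by congr (_, _, _); lia.
- move=> b b0 Mb.
  (* These are the squared norms of the rows of W, positive because class p contains [sect p]. *)
  pose g : 'rV[R]_k' := \row_p \sum_(i | cls i == p) (a i) `^ r ^+ 2.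
  apply: (affine_powmx_simple_eigenvalue J yJ yh (W := W) (g := g) _ _ ME) => //.
    apply/matrixP => p q; rewrite !mxE.
    have [->|pq] := eqVneq p q.
      rewrite [RHS]big_mkcond; apply: eq_bigr => i _; rewrite !mxE.
      by case: eqP; rewrite ?mulr0// -expr2.
    apply: big1 => i _; rewrite !mxE; case: (eqVneq (cls i) p) => [->|_]; last by rewrite mul0r.
    by rewrite (negbTE pq) mulr0.
  move=> p; rewrite mxE (bigD1 (sect p)) ?sectK//=; apply: ltr_wpDr.
    by apply: sumr_ge0 => i _; rewrite sqr_ge0.
  by rewrite exprn_gt0// powR_gt0.
Qed.
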